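(* Let $$\mathcal R_{123}=\Psi_q\big(\kappa_1\kappa_3^{-1}e^{p_1+u_1+p_3-u_3-p_2}\big)\,\rho_{23}\,e^{\frac1\hbar p_1(u_3-u_2)}\,e^{\frac{\lambda_{23}}\hbar(u_3-u_1)}.$$ In the $u$-representation, the matrix elements of $\mathcal R_{123}$ are $$R^{a_1,a_2,a_3}_{b_1,b_2,b_3}(\lambda_1,\lambda_2,\lambda_3):=\langle a_1,a_2,a_3|\mathcal R_{123}|b_1,b_2,b_3\rangle=\frac{(-q)^{a_2-b_3}}{(q^2;q^2)_{a_2-b_3}}\,q^{(b_1-b_3+n_{13})(a_2-b_3-n_{23})+n_{13}n_{23}}\,\delta^{a_1+a_2}_{b_1+b_2}\,\delta^{a_2+a_3}_{b_2+b_3}$$ for all $a_i,b_i\in\mathbb Z$, where $n_{ij}=\frac{\lambda_{ij}}\hbar$.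
   Context: $\hbar$ is a generic complex parameter, $q=e^\hbar$, $q^x=e^{\hbar x}$; $\lambda_1,\lambda_2,\lambda_3\in\mathbb C$, $\kappa_j=e^{\lambda_j}$, $\lambda_{jk}=\lambda_j-\lambda_k$. $[p_i,u_j]=\hbar\delta_{ij}$, $[p_i,p_j]=[u_i,u_j]=0$ for $i,j\in\{1,2,3\}$; exponentials of linear combinations follow $e^Ae^B=e^{[A,B]/2}e^{A+B}$. $u$-representation: on $V=\bigoplus_{a\in\mathbb Z}\mathbb C|a\rangle$, for the $i$-th tensor factor of $V^{\otimes3}$, $e^{p_i}|a_i\rangle=|a_i-1\rangle$, $e^{u_i}|a_i\rangle=q^{a_i}|a_i\rangle$, more precisely $u_i|a_i\rangle=\hbar a_i|a_i\rangle$. Thus $e^{\frac1\hbar p_1(u_3-u_2)}|a,b,c\rangle=e^{(c-b)p_1}|a,b,c\rangle$. $\rho_{23}$ exchanges the second and third components. $|a_1,a_2,a_3\rangle=|a_1\rangle\otimes|a_2\rangle\otimes|a_3\rangle$ and $\langle a_i|$ is the dual basis, $\langle a|a'\rangle=\delta_{a,a'}$. $\Psi_q(U)=\sum_{n\ge0}\frac{(-qU)^n}{(q^2;q^2)_n}$ (matrix elements are computed termwise), $(z;q)_n=(z;q)_\infty/(zq^n;q)_\infty$ for $n\in\mathbb Z$ with $(z;q)_\infty=\prod_{k\ge0}(1-zq^k)$; in particular $1/(q^2;q^2)_n=0$ for $n<0$. $\delta^a_b$ is the Kronecker delta. *)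

(* Defs.v *)
From HB Require Import structures.
From mathcomp Require Import all_boot all_order all_algebra.
From mathcomp Require Import classical_sets boolp reals topology normedtype sequences exp trigo.
From mathcomp Require Import complex freeg.
From mathcomp Require Import ring lra.

Set Implicit Arguments.
Unset Strict Implicit.
Unset Printing Implicit Defensive.

Import Order.TTheory GRing.Theory Num.Theory.
Import numFieldNormedType.Exports.

Local Open Scope ring_scope.
Local Open Scope complex_scope.

Section QSymbols.
Context (R : realType).
Implicit Types (z w q h x : R[i]).

(* Library limits need a topology, which R[i] carries under its alias R[i]^o. *)
Definition climit (s : nat -> R[i]) : R[i] :=
  lim ((s : nat -> R[i]^o) @ \oo)%classic.

Definition cexp z : R[i] :=
  let: a +i* b := z in (expR a * cos b) +i* (expR a * sin b).

(* q ^ x, for q = e ^ h. *)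
Definition qpow h x : R[i] := cexp (h * x).

(* (z; q)_oo *)
Definition qpoch_inf z q : R[i] :=
  climit (fun N => \prod_(k < N) (1 - z * q ^+ k)).

Definition qpoch_fin z q (n : int) : R[i] :=
  match n with
  | Posz m => \prod_(k < m) (1 - z * q ^+ k)
  | Negz m => (\prod_(k < m.+1) (1 - z * q ^- k.+1))^-1
  end.

(* (z; q)_n.  The infinite products only make sense for `|q| < 1; for the
   other q the symbol is the quotient with the common factors cancelled.
   A pole of (z; q)_n gets the value 0 (division by 0), so that its
   reciprocal is 0, as it should be. *)
Definition qpoch z q (n : int) : R[i] :=
  if `|q| < 1 then qpoch_inf z q / qpoch_inf (z * q ^ n) q
  else qpoch_fin z q n.

Lemma cexp0 : cexp 0 = 1.
Proof. by rewrite /cexp /= expR0 cos0 sin0 !mul1r. Qed.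

Lemma cexpD z w : cexp (z + w) = cexp z * cexp w.
Proof.
case: z w => [a b] [c d]; rewrite /cexp /= expRD cosD sinD.
by apply/eqP; rewrite eq_complex /=; apply/andP; split; apply/eqP; ring.
Qed.

Lemma cexp_neq0 z : cexp z != 0.
Proof.
apply/eqP => z0; have := cexpD z (- z).
by rewrite subrr cexp0 z0 mul0r => /eqP; rewrite oner_eq0.
Qed.

Lemma climit_eventually_cst (s : nat -> R[i]) N c :
  (forall n, (N <= n)%N -> s n = c) -> climit s = c.
Proof.
move=> sc; apply: (@cvg_lim R[i]^o); first exact: norm_hausdorff.
by apply: cvg_near_cst; exists N => // n /= Nn; rewrite sc.
Qed.

(* 1 / (q^2; q^2)_n = 0 for n < 0. *)
Lemma qpoch_neg_inv q (n : int) : q != 0 -> n < 0 ->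
  (qpoch (q ^+ 2) (q ^+ 2) n)^-1 = 0.
Proof.
move=> q0; case: n => // m _; have Q0 : q ^+ 2 != 0 by rewrite expf_neq0.
rewrite /qpoch; case: ifP => _; last first.
  rewrite /qpoch_fin big_ord_recl /= expr1 mulfV // subrr mul0r.
  by rewrite !invr0.
rewrite invfM invrK mulrC /qpoch_inf.
rewrite (@climit_eventually_cst _ m.+1 0) ?mul0r // => n mn.
rewrite (bigD1 (Ordinal mn)) //= NegzE -exprnN.
by rewrite mulrAC -exprS mulfV ?expf_neq0// subrr mul0r.
Qed.
End QSymbols.


(* (a1, a2, a3) indexes the basis vector |a1, a2, a3> = |a1> (x) |a2> (x) |a3>
   of the triple tensor power of V = \bigoplus_(a in Z) C |a>, which is thus
   the free module over these triples. *)
Notation idx := (int * int * int)%type.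
Notation V3 R := {freeg idx / R[i]}.

Section Operators.
Context (R : realType).
Local Notation C := R[i].
Local Notation V3 := (V3 R).
Implicit Types (h q : C) (v w : V3) (a b m : idx).

Definition ket a : V3 := << a >>.

(* The linear map with given values on the basis. *)
Definition linext (f : idx -> V3) : V3 -> V3 := fglift f.

(* ((m1, m2, m3), (c1, c2, c3)) stands for the linear combination
   \sum_i m_i p_i + \sum_i c_i u_i; the m_i are integers because exp (c p_i)
   acts on V only for integral c. *)
Local Notation linform := ((int * int * int) * (C * C * C))%type.

Definition p1 : linform := ((1, 0, 0), 0).
Definition p2 : linform := ((0, 1, 0), 0).
Definition p3 : linform := ((0, 0, 1), 0).
(* c u_i *)
Definition cu1 (c : C) : linform := (0, (c, 0, 0)).
Definition cu2 (c : C) : linform := (0, (0, c, 0)).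
Definition cu3 (c : C) : linform := (0, (0, 0, c)).
Definition u1 : linform := cu1 1.
Definition u2 : linform := cu2 1.
Definition u3 : linform := cu3 1.

Definition pairing m (c : C * C * C) : C :=
  m.1.1%:~R * c.1.1 + m.1.2%:~R * c.1.2 + m.2%:~R * c.2.

(* The scalar [A, B], from [p_i, u_j] = h delta_ij. *)
Definition comm h (A B : linform) : C :=
  h * (pairing A.1 B.2 - pairing B.1 A.2).

(* exp (\sum_i m_i p_i) *)
Definition expp m : V3 -> V3 := linext (fun a => ket (a - m)).

(* exp (\sum_i c_i u_i); u_i has the eigenvalue h a_i on |a1, a2, a3>. *)
Definition expu h (c : C * C * C) : V3 -> V3 :=
  linext (fun a => cexp (h * pairing a c) *: ket a).

(* exp (P + U) = exp (- [P, U] / 2) exp P exp U; see expLD for the general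
   product rule. *)
Definition expL h (A : linform) v : V3 :=
  cexp (- comm h (A.1, 0) (0, A.2) / 2) *: expp A.1 (expu h A.2 v).

Definition rho23 : V3 -> V3 :=
  linext (fun a => ket (a.1.1, a.2, a.1.2)).

(* exp (p1 (u3 - u2) / h): on |a1, a2, a3> the operator (u3 - u2) / h is the
   integer a3 - a2. *)
Definition exp_p1u32 h : V3 -> V3 :=
  linext (fun a => expL h (p1 *~ (a.2 - a.1.2)) (ket a)).

(* Psi_q(U) v is an infinite combination of basis vectors, given here by its
   coefficients: the series for Psi_q is summed coefficientwise. *)
Definition Psi q (U : V3 -> V3) v : idx -> C := fun a =>
  climit (fun N => \sum_(n < N)
    coeff a (iter n (fun w => (- q) *: U w) v) / qpoch (q ^+ 2) (q ^+ 2) n%:Z).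

Definition R123 h l1 l2 l3 v : idx -> C :=
  Psi (cexp h)
    (fun w => (cexp l1 / cexp l3) *: expL h (p1 + u1 + p3 - u3 - p2) w)
    (rho23 (exp_p1u32 h (expL h (cu3 ((l2 - l3) / h) - cu1 ((l2 - l3) / h)) v))).

(* <a1, a2, a3| R_123 |b1, b2, b3> *)
Definition R123_elt h l1 l2 l3 a b : C := R123 h l1 l2 l3 (ket b) a.

Lemma fglift_linear (f : idx -> V3) : linear (fglift f).
Proof.
move=> k v w; rewrite -[v in LHS](freeg_sumE) -[v in RHS](freeg_sumE).
have N : {morph fglift f : x / - x}.
  move=> x; have := lift_is_additive f 0 x; rewrite sub0r => ->.
  by have := lift_is_additive f 0 0; rewrite subrr => ->; rewrite subrr sub0r.
have D : {morph fglift f : x y / x + y}.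
  by move=> x y; rewrite -[y in LHS]opprK lift_is_additive N opprK.
have Z0 : fglift f 0 = 0.
  by have := lift_is_additive f 0 0; rewrite !subrr.
rewrite D; congr (_ + _); rewrite scaler_sumr !(big_morph _ D Z0) scaler_sumr.
apply: eq_bigr => a _; rewrite [in RHS]liftU scalerA.
have -> : k *: << coeff a v *g a >> = << k * coeff a v *g a >> :> V3.
  by apply/eqP/freeg_eqP => x; rewrite coeffZ !coeffU mulrA.
by rewrite liftU.
Qed.

HB.instance Definition _ f :=
  GRing.isLinear.Build C V3 V3 _ (linext f) (fglift_linear f).
HB.instance Definition _ m := GRing.Linear.on (expp m).
HB.instance Definition _ h c := GRing.Linear.on (expu h c).
HB.instance Definition _ := GRing.Linear.on rho23.
HB.instance Definition _ h := GRing.Linear.on (exp_p1u32 h).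

Lemma linext_ket (f : idx -> V3) a : linext f (ket a) = f a.
Proof. by rewrite /linext liftU scale1r. Qed.

Lemma expL_linear h A : linear (expL h A).
Proof. by move=> k v w; rewrite /expL !linearP /= scalerA mulrC -scalerA. Qed.

HB.instance Definition _ h A :=
  GRing.isLinear.Build C V3 V3 _ (expL h A) (expL_linear h A).

Lemma expL_ket h A a :
  expL h A (ket a) =
  cexp (h * (pairing a A.2 - pairing A.1 A.2 / 2)) *: ket (a - A.1).
Proof.
rewrite /expL /expu linext_ket [expp _ _]linearZ /= /expp linext_ket.
rewrite scalerA -cexpD; congr (cexp _ *: _).
by rewrite /comm /pairing /=; field.
Qed.

Lemma comm_pu h : [/\ comm h p1 u1 = h, comm h p2 u2 = h & comm h p3 u3 = h].
Proof. by split; rewrite /comm /pairing /=; ring. Qed.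

Lemma pairingDl m1 m2 c : pairing (m1 + m2) c = pairing m1 c + pairing m2 c.
Proof. by rewrite /pairing /= !intrD; ring. Qed.

Lemma pairingDr m c1 c2 : pairing m (c1 + c2) = pairing m c1 + pairing m c2.
Proof. by rewrite /pairing /=; ring. Qed.

Lemma eq_on_ket (f g : V3 -> V3) : linear f -> linear g ->
  (forall a, f (ket a) = g (ket a)) -> f =1 g.
Proof.
move=> lf lg fg v; rewrite -[v]freeg_sumE.
elim: (dom v) => [|a s IH].
  rewrite big_nil; move: (lf (-1) 0 0) (lg (-1) 0 0).
  by rewrite scaler0 addr0 !scaleN1r !addNr => -> ->.
rewrite big_cons; set w := \sum_(z <- s) _ in IH *.
have -> : << coeff a v *g a >> = coeff a v *: ket a.
  by apply/eqP/freeg_eqP => x; rewrite coeffZ !coeffU mul1r.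
by rewrite lf lg fg IH.
Qed.

Lemma expLD h A B v :
  expL h A (expL h B v) = cexp (comm h A B / 2) *: expL h (A + B) v.
Proof.
move: v; apply: eq_on_ket => [k v w|k v w|a].
- by rewrite !linearP.
- by rewrite !expL_linear scalerDr !scalerA (mulrC k).
rewrite [expL h B _]expL_ket [expL h A _]linearZ /= !expL_ket !scalerA -!cexpD.
congr (cexp _ *: ket _); last by rewrite opprD addrA addrAC.
have -> : pairing (a - B.1) A.2 = pairing a A.2 - pairing B.1 A.2.
  by apply/esym/eqP; rewrite subr_eq -pairingDl subrK.
by rewrite pairingDl !pairingDr /comm; field.
Qed.
End Operators.

(* Main.v *)
Require Import Defs.
From mathcomp Require Import all_boot all_order all_algebra.
From mathcomp Require Import reals complex freeg.
From mathcomp Require Import ring zify.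

Import GRing.Theory Num.Theory.

Local Open Scope ring_scope.

(* Each factor of R_123 maps a basis vector to a multiple of a basis vector, and
   so does the argument U of Psi_q: it shifts (x, y, z) to (x-1, y+1, z-1).
   Hence at most one term of the series Psi_q(U) contributes to a given matrix
   element, namely the one with n = a2 - b3. *)

Section MatrixElements.
Context (R : realType).
Implicit Types (h q x y : R[i]) (a b : idx).

Lemma qpowD h x y : qpow h (x + y) = qpow h x * qpow h y.
Proof. by rewrite /qpow mulrDr cexpD. Qed.

Lemma qpowMn h x n : qpow h (x * n%:R) = qpow h x ^+ n.
Proof.
elim: n => [|n IH]; first by rewrite mulr0 /qpow mulr0 cexp0.
by rewrite exprS -IH -qpowD mulrSr mulrDr mulr1 addrC.
Qed.

Lemma coeff_ket a b : coeff a (ket R b) = (a == b)%:R.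
Proof. by rewrite coeffU mul1r eq_sym. Qed.

(** For [k >= 0] the partial sums are constant from [N = k + 1] on. For [k < 0] no index meets [k]
    and all of them vanish, hence the hypothesis on [f]. *)
Lemma climit_series_delta (k : int) (f : int -> R[i]) :
  (k < 0 -> f k = 0) ->
  climit (fun N => \sum_(n < N) (n%:Z == k)%:R * f n%:Z) = f k.
Proof.
case: k => [m _|m f0].
  apply: (@climit_eventually_cst _ _ m.+1) => N mN.
  rewrite (bigD1 (Ordinal mN)) //= eqxx mul1r big1 ?addr0 // => i.
  by rewrite -val_eqE /= => /negPf im; rewrite eqz_nat im mul0r.
rewrite f0 //; apply: (@climit_eventually_cst _ _ 0%N) => N _.
by apply: big1 => i _; rewrite mul0r.
Qed.

(** Explicit components let [expL_ket] evaluate the integer multiple of [p1] in [exp_p1u32]. *)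
Lemma p1_mulrz (k : int) : p1 R *~ k = ((k, 0, 0), 0).
Proof.
have p1Mn n : p1 R *+ n = ((n%:Z, 0, 0), 0).
  elim: n => [|n IH] //; rewrite mulrS IH /p1.
  by congr (_, _, _, _); rewrite /= ?addr0 // -add1n PoszD.
case: k => n; first exact: p1Mn.
rewrite NegzE mulrNz -[_ *~ _]/(p1 R *+ n.+1) p1Mn.
by congr (_, _, _, _); rewrite /= oppr0.
Qed.

Lemma expL_cu31_ket h x (b1 b2 b3 : int) :
  expL h (cu3 x - cu1 x) (ket R (b1, b2, b3)) =
  qpow h (x * (b3 - b1)%:~R) *: ket R (b1, b2, b3).
Proof.
rewrite expL_ket; congr (_ *: _).
  rewrite /qpow; congr (cexp (_ * _)).
  by rewrite /pairing /= !rmorphB /=; field.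
by congr ket; congr (_, _, _); rewrite /= !subr0.
Qed.

Lemma exp_p1u32_ket h (b1 b2 b3 : int) :
  exp_p1u32 h (ket R (b1, b2, b3)) = ket R (b1 - (b3 - b2), b2, b3).
Proof.
rewrite /exp_p1u32 linext_ket /= p1_mulrz expL_ket /pairing /=.
rewrite !(mulr0, mul0r, addr0, oppr0) cexp0 scale1r.
by congr ket; congr (_, _, _); rewrite /= subr0.
Qed.

(* The eigenvalue q^(x - z) of e^(u1 - u3) is not changed by the shift, so the
   powers of this operator are given by the powers of one scalar. *)
Lemma iter_Psi_arg_ket h (q k c : R[i]) (x y z : int) n :
  iter n (fun w => (- q) *: (k *: expL h (p1 R + u1 R + p3 R - u3 R - p2 R) w))
    (c *: ket R (x, y, z)) =
  (c * ((- q) * k * qpow h (x - z)%:~R) ^+ n) *: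
    ket R (x - n%:Z, y + n%:Z, z - n%:Z).
Proof.
elim: n => [|n IH].
  rewrite expr0 mulr1 -[RHS]/(c *: ket R (x - 0, y + 0, z - 0)).
  by rewrite addr0 !subr0.
rewrite iterS IH [expL _ _ _]linearZ /= expL_ket !scalerA exprSr.
congr (_ *: _); last first.
  by congr ket; congr (_, _, _); rewrite /=; lia.
(* The half-commutator in [expL_ket] vanishes: pairing [p1 + p3 - p2] with [u1 - u3] gives
   [1 - 1 = 0]. *)
set e := cexp _; have -> : e = qpow h (x - z)%:~R; last by ring.
rewrite /e /qpow; congr (cexp (_ * _)).
by rewrite /pairing /= !rmorphD !rmorphN /=; field.
Qed.
End MatrixElements.

Theorem proposition6p1 (R : realType) (h l1 l2 l3 : R[i])
    (h_generic : forall n : nat, (0 < n)%N -> cexp h ^+ n != 1)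
    (a1 a2 a3 b1 b2 b3 : int) :
  let q := cexp h in
  let n13 := (l1 - l3) / h in
  let n23 := (l2 - l3) / h in
  R123_elt h l1 l2 l3 (a1, a2, a3) (b1, b2, b3) =
    (- q) ^ (a2 - b3) / qpoch (q ^+ 2) (q ^+ 2) (a2 - b3)
    * qpow h (((b1 - b3)%:~R + n13) * ((a2 - b3)%:~R - n23) + n13 * n23)
    * (a1 + a2 == b1 + b2)%:R * (a2 + a3 == b2 + b3)%:R.
Proof.
move=> q n13 n23.
(* Genericity at exponent 1 excludes [h = 0], which allows division by [h]. *)
have h0 : h != 0.
  by apply/eqP => h0; have := h_generic 1%N isT; rewrite h0 cexp0 eqxx.
have kE : cexp l1 / cexp l3 = qpow h n13.
  apply: (canLR (mulfK (cexp_neq0 _))).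
  by rewrite /qpow /n13 -cexpD; congr cexp; field.
rewrite /R123_elt /R123 /Psi expL_cu31_ket [exp_p1u32 _ _]linearZ.
rewrite [rho23 _]linearZ /= -/q -/n23 kE.
set c := qpow h (n23 * _).
rewrite exp_p1u32_ket /rho23 linext_ket /=.
(* [Psi] now acts on [c] times the ket [(b1 - b3 + b2, b3, b2)], whose outer entries differ by
   [b1 - b3]. *)
pose s := (- q) * qpow h n13 * qpow h (b1 - b3)%:~R.
pose d : R[i] := (a1 + a2 == b1 + b2)%:R * (a2 + a3 == b2 + b3)%:R.
pose f n := d * c * s ^ n / qpoch (q ^+ 2) (q ^+ 2) n.
transitivity (f (a2 - b3)).
  rewrite -climit_series_delta.
    congr climit; apply: boolp.funext => N; apply: eq_bigr => n _.
    rewrite iter_Psi_arg_ket coeffZ coeff_ket.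
    have -> : b1 - (b3 - b2) - b2 = b1 - b3 by ring.
    rewrite /f -/s -[s ^ n%:Z]/(s ^+ n).
    (* The middle coordinate fixes [n]; substituting it into the other two gives the two
       conservation laws in [d]. *)
    have -> : ((a1, a2, a3) == (b1 - (b3 - b2) - n%:Z, b3 + n%:Z, b2 - n%:Z))%:R
      = (n%:Z == a2 - b3)%:R * d :> R[i].
      rewrite /d -!natrM !mulnb !xpair_eqE; congr (nat_of_bool _)%:R.
      by lia.
    by ring.
  by move=> n0; rewrite /f qpoch_neg_inv ?mulr0 ?cexp_neq0.
(* For negative [a2 - b3] both sides vanish, by the reciprocal q-symbol. *)
rewrite /f /d; case: (a2 - b3) => m; last first.
  by rewrite qpoch_neg_inv ?cexp_neq0// !(mulr0, mul0r).
rewrite -[s ^ _]/(s ^+ m) -[(- q) ^ _]/((- q) ^+ m) /s !exprMn -!qpowMn.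
set e := qpow h (_ + _).
(* Expanding the product yields [- n13 * n23], cancelled by the added [n13 * n23]; the term
   [- n23 * (b1 - b3)] is the exponent of [c]. *)
have -> : e = c * qpow h (n13 * m%:R) * qpow h ((b1 - b3)%:~R * m%:R).
  rewrite /e /c -!qpowD !rmorphB /=; congr qpow.
  by rewrite -[m%:~R]/(m%:R); ring.
by ring.
Qed.
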